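(* Let $0<\alpha<1$, $\tau>0$, let $\lambda$ be a (real or complex) constant, let $f:[0,+\infty)\to\mathbb{R}$ be continuous, and let $\phi(t)=(t/\tau+1)y_0$, $t\in[-\tau,0]$, for some $y_0\in\mathbb{R}$. Then for every $t>0$ the solution $\hat y$ of $$ {}^{\phi_\tau}\!D^{\alpha}_{0}\hat y(t)=\lambda\hat y(t-\tau)+f(t)\ (t>0),\qquad \hat y(t)=\phi(t)\ (-\tau\le t\le0) $$ is $$ \hat y(t)=\frac{y_0}{\tau}\left[\lambda^{p+1}\frac{(t-p\tau)^{\alpha(p+1)+1}}{\Gamma(\alpha(p+1)+2)}+\sum_{k=0}^{p}\lambda^{k}\frac{(t+\tau-k\tau)^{\alpha k+1}}{\Gamma(\alpha k+2)}\,I_{\frac{\tau}{t+\tau-k\tau}}\bigl(2-\alpha,(k+1)\alpha\bigr)\right]+\mathcal{J}_{0,\tau,\lambda}f(t), $$ where $p$ is the nonnegative integer such that $t\in[p\tau,(p+1)\tau)$.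
   Context: $I_x(a,b)=\frac{1}{B(a,b)}\int_0^x r^{a-1}(1-r)^{b-1}\,dr$ is the (regularized) incomplete beta function, with $B(a,b)$ the Euler beta function. The generalized integral is $$\mathcal{J}_{0,\tau,\lambda}f(t):=\sum_{k=0}^{\lfloor t/\tau\rfloor}\frac{\lambda^k}{\Gamma(\alpha k+\alpha)}\int_0^{t-k\tau}(t-k\tau-r)^{\alpha k+\alpha-1}f(r)\,dr .$$ For a starting point $t_0$, the Caputo derivative is ${}^{C}\!D^{\alpha}_{t_0}u(t)=\frac{1}{\Gamma(1-\alpha)}\int_{t_0}^t(t-r)^{-\alpha}u'(r)\,dr$. The operator ${}^{\phi_\tau}\!D^{\alpha}_{0}$ is the Grünwald-Letnikov derivative modified to incorporate the initial function: ${}^{\phi_\tau}\!D^{\alpha}_{0}u(t)=\lim_{h\to0^+}h^{-\alpha}\sum_{j=0}^\infty\omega_j^{(\alpha)}u^{\phi_\tau}(t-jh)$, with $\omega_j^{(\alpha)}=\frac{(-1)^j\Gamma(\alpha+1)}{j!\,\Gamma(\alpha-j+1)}$, where $u^{\phi_\tau}$ equals $\phi(-\tau)$ on $(-\infty,-\tau)$, $\phi$ on $[-\tau,0]$, and $u$ on $(0,\infty)$. It satisfies ${}^{\phi_\tau}\!D^{\alpha}_{0}u={}^{C}\!D^{\alpha}_{0}u+{}^{C}\!D^{\alpha}_{-\tau}\phi-{}^{C}\!D^{\alpha}_{0}\phi$ (for $t>0$, $\phi$ is extended by the same formula $\phi(t)=(t/\tau+1)y_0$), so the problem for $\hat y$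 is understood as the equivalent problem $${}^{C}\!D^{\alpha}_{0}\hat y(t)=\lambda\hat y(t-\tau)+f(t)+c(t),\qquad c(t)={}^{C}\!D^{\alpha}_{0}\phi(t)-{}^{C}\!D^{\alpha}_{-\tau}\phi(t)=\frac{y_0}{\tau\,\Gamma(2-\alpha)}\bigl(t^{1-\alpha}-(t+\tau)^{1-\alpha}\bigr),$$ with $\hat y=\phi$ on $[-\tau,0]$. A solution of a problem ${}^{C}\!D^{\alpha}_{0}u(t)=\lambda u(t-\tau)+F(t)$, $u=\phi$ on $[-\tau,0]$, is a continuous function on $[-\tau,\infty)$ with $u=\phi$ on $[-\tau,0]$ satisfying the equivalent integral form $u(t)=\phi(0)+\frac{1}{\Gamma(\alpha)}\int_0^t(t-r)^{\alpha-1}\bigl[\lambda u(r-\tau)+F(r)\bigr]dr$ for $t\ge0$. *)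

(* Defs.v *)
From HB Require Import structures.
From mathcomp Require Export all_boot all_order all_algebra.
From mathcomp Require Export all_classical all_reals all_analysis.
From mathcomp Require Export complex.

Set Implicit Arguments.
Unset Strict Implicit.
Unset Printing Implicit Defensive.

Import Order.TTheory GRing.Theory Num.Theory.
Import numFieldNormedType.Exports.

Local Open Scope classical_set_scope.
Local Open Scope ring_scope.
Local Open Scope complex_scope.

Section SpecialFunctions.
Context {R : realType}.
Local Notation mu := (@lebesgue_measure R).
Implicit Types a b x z : R.

Definition Gamma z : R :=
  \int[mu]_(r in `]0, +oo[) (r `^ (z - 1) * expR (- r)).

Definition Beta a b : R :=
  \int[mu]_(r in `]0, 1[) (r `^ (a - 1) * (1 - r) `^ (b - 1)).

Definition reg_inc_beta x a b : R :=
  (Beta a b)^-1 * \int[mu]_(r in `]0, x[) (r `^ (a - 1) * (1 - r) `^ (b - 1)).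

End SpecialFunctions.

Section DelayProblem.
Context {R : realType}.
Local Notation mu := (@lebesgue_measure R).
Implicit Types (alpha tau t : R) (lambda : R[i]) (f phi F : R -> R).
Implicit Types u g : R -> R[i].

Definition Cintegral (D : set R) g : R[i] :=
  (\int[mu]_(r in D) complex.Re (g r)) +i* (\int[mu]_(r in D) complex.Im (g r)).

Definition caputo alpha t0 f t : R :=
  (Gamma (1 - alpha))^-1 *
  \int[mu]_(r in `]t0, t[) ((t - r) `^ (- alpha) * derive1 f r).

(* Solutions of  D^alpha u(t) = lambda u(t - tau) + F(t)  (Caputo derivative
   from 0) with u = phi on [-tau, 0], in the sense of the equivalent integral
   equation; values of u on ]-oo, -tau[ are irrelevant. *)
Definition delay_solution alpha tau lambda phi F u : Prop :=
  [/\ {within `[- tau, +oo[, continuous (u : R -> (R[i] : numFieldType))},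
      forall t, - tau <= t <= 0 -> u t = (phi t)%:C
    & forall t, 0 <= t ->
        u t = (phi 0)%:C + ((Gamma alpha)^-1)%:C *
          Cintegral `]0, t[ (fun r =>
            ((t - r) `^ (alpha - 1))%:C * (lambda * u (r - tau) + (F r)%:C))].

(* For phi extended to the right of 0 by its own formula, the
   Gruenwald-Letnikov derivative of u modified by phi is
     caputo 0 u + caputo (- tau) phi - caputo 0 phi,
   so moving the phi-terms to the right-hand side adds this to the forcing. *)
Definition history_forcing alpha tau phi t : R :=
  caputo alpha 0 phi t - caputo alpha (- tau) phi t.

Definition modified_GL_solution alpha tau lambda phi f u : Prop :=
  delay_solution alpha tau lambda phi
    (fun t => f t + history_forcing alpha tau phi t) u.

Definition affine_history tau (y0 : R) t : R := (t / tau + 1) * y0.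

Definition Jint alpha tau lambda f t : R[i] :=
  \sum_(k < (Num.truncn (t / tau)).+1)
    (lambda ^+ k * ((Gamma (alpha * k%:R + alpha))^-1 *
      \int[mu]_(r in `]0, t - k%:R * tau[)
        ((t - k%:R * tau - r) `^ (alpha * k%:R + alpha - 1) * f r))%:C).

End DelayProblem.

(* Main.v *)
(* Write J^b for the Riemann-Liouville integral of order b, P_b = J^b 1 (that is
   t^b / Gamma(b + 1) for t >= 0, and 0 for t <= 0) and F = f + c for the full
   right-hand side. Put
     W_k(t) = y0/tau (P_{alpha k + 1}(t) - P_{alpha k + 1}(t - tau))
              + (J^{alpha k + alpha} F)(t - tau).
   The semigroup law J^a J^b = J^{a + b} gives J^alpha W_k = W_{k+1}, each W_k
   vanishes on t <= 0, and W_0(t + tau) is phi(t) for - tau <= t <= 0 and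
   y0 + J^alpha F(t) for t >= 0; so u(t) = sum_k lambda^k W_k(t + tau - k tau)
   solves the integral equation. Two solutions agree by induction on the
   intervals of length tau.
   As c = y0/tau (P_{1-alpha} - P_{1-alpha}(. + tau)), cutting the integral
   J^b P_{1-alpha}(t + tau) at tau expresses J^b c through the incomplete Beta
   function. For 0 <= t - k tau all powers cancel except the Beta terms, and the
   last nonzero term k = p + 1 is the isolated power lambda^(p+1).
   The semigroup law follows from Tonelli's theorem (associativity of
   convolution) and B(a, b) = Gamma(a) Gamma(b) / Gamma(a + b), itself the
   integral of the convolution of x^(a-1) e^-x and x^(b-1) e^-x. *)
Require Import Defs.
From mathcomp Require Import measurable_realfun ring lra.
Import Order.TTheory GRing.Theory Num.Theory.
Import numFieldNormedType.Exports.
Local Open Scope classical_set_scope.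
Local Open Scope ring_scope.
Local Open Scope complex_scope.

Set Implicit Arguments.
Unset Strict Implicit.
Unset Printing Implicit Defensive.

(** * Affine change of variables and convolution on the line *)

Section AffineChange.
Context {R : realType}.
Local Notation mu := (@lebesgue_measure R).
Variables a b : R.
Hypothesis a0 : a != 0.

Let phi (x : R) : measurableTypeR R := a * x + b.

Let mphi : measurable_fun setT phi.
Proof. by apply: measurable_funD => //; exact: measurable_funM. Qed.

Let preimage_ocitv (c d : R) : phi @^-1` `]c, d]%classic =
  if 0 < a then `](c - b) / a, (d - b) / a]%classic
  else `[(d - b) / a, (c - b) / a[%classic.
Proof.
rewrite /phi; case: ltrgt0P a0 => // a_pos _; apply/seteqP; split=> x /=;
  rewrite !in_itv/= ?ltr_pdivrMr// ?ler_pdivlMr// ?ler_ndivrMr// ?ltr_ndivlMr//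
    ltrBlDr lerBrDr (mulrC x).
all: by rewrite // andbC.
Qed.

(** Lebesgue measure is determined by its values on the intervals []c, d]]; on these the factor
    [|a|] undoes the division by [a], the ends being exchanged when [a < 0]. *)
Let mscale_pushforward (A : set R) : measurable A ->
  (`|a|%:E * pushforward mu phi A = mu A)%E.
Proof.
move=> mA.
rewrite [in RHS](@lebesgue_measure_unique _
  (mscale (NngNum (normr_ge0 a)) (pushforward mu phi)))//=.
move=> _ [[c d]] _ <-; rewrite /mscale/= /pushforward preimage_ocitv.
case: ltrgt0P a0 => // a_pos _; rewrite !lebesgue_measure_itv/= !lte_fin.
  rewrite ltr_pM2r ?invr_gt0// ltrD2r; case: ifPn => cd; last by rewrite mule0.
  by rewrite -EFinB -EFinM; congr EFin; field.
rewrite ltr_nM2r ?invr_lt0// ltrD2r; case: ifPn => cd; last by rewrite mule0.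
by rewrite -EFinB -EFinM; congr EFin; field.
Qed.

Lemma ge0_integral_affine (f : R -> \bar R) :
  measurable_fun setT f -> (forall x, (0 <= f x)%E) ->
  (`|a|%:E * \int[mu]_x f (a * x + b)%R = \int[mu]_x f x)%E.
Proof.
move=> mf f0.
have /= <- := @ge0_integral_pushforward _ _ (measurableTypeR R)
  (measurableTypeR R) R phi mphi mu setT f measurableT mf (fun y _ => f0 y).
rewrite -(ge0_integral_mscale _ _ (NngNum (normr_ge0 a)))//.
by apply: eq_measure_integral => A mA _ /=; exact: mscale_pushforward.
Qed.

End AffineChange.

Section Isometries.
Context {R : realType}.
Local Notation mu := (@lebesgue_measure R).

Lemma ge0_integral_shift (b : R) (f : R -> \bar R) :
  measurable_fun setT f -> (forall x, (0 <= f x)%E) ->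
  (\int[mu]_x f (x + b)%R = \int[mu]_x f x)%E.
Proof.
move=> mf f0; rewrite -(@ge0_integral_affine _ 1 b _ f)// normr1 mul1e.
by under [RHS]eq_integral do rewrite mul1r.
Qed.

Lemma ge0_integral_reflect (b : R) (f : R -> \bar R) :
  measurable_fun setT f -> (forall x, (0 <= f x)%E) ->
  (\int[mu]_x f (b - x)%R = \int[mu]_x f x)%E.
Proof.
move=> mf f0; rewrite -(@ge0_integral_affine _ (-1) b _ f)// normrN1 mul1e.
by under [RHS]eq_integral do rewrite mulN1r addrC.
Qed.

(** Splitting into positive and negative parts reduces the claim to the nonnegative case. *)
Lemma integral_shift (b : R) (f : R -> \bar R) : measurable_fun setT f ->
  (\int[mu]_x f (x + b)%R = \int[mu]_x f x)%E.
Proof.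
move=> mf; rewrite integralE [in RHS]integralE.
congr (_ - _)%E.
  under eq_integral do rewrite funeposE -(funeposE f).
  by apply: ge0_integral_shift => //; exact: measurable_funepos.
under eq_integral do rewrite funenegE -(funenegE f).
by apply: ge0_integral_shift => //; exact: measurable_funeneg.
Qed.

Lemma integral_reflect (b : R) (f : R -> \bar R) : measurable_fun setT f ->
  (\int[mu]_x f (b - x)%R = \int[mu]_x f x)%E.
Proof.
move=> mf; rewrite integralE [in RHS]integralE.
congr (_ - _)%E.
  under eq_integral do rewrite funeposE -(funeposE f).
  by apply: ge0_integral_reflect => //; exact: measurable_funepos.
under eq_integral do rewrite funenegE -(funenegE f).
by apply: ge0_integral_reflect => //; exact: measurable_funeneg.
Qed.

End Isometries.

Section Convolution.
Context {R : realType}.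
Local Notation mu := (@lebesgue_measure R).
Local Open Scope ereal_scope.
Implicit Types f g h : R -> \bar R.

(** Taken over the whole line with extended real values, so that Tonelli's theorem applies directly;
    integrals over []0, t[] arise when both factors vanish left of 0. *)
Definition conv f g (t : R) : \bar R := \int[mu]_r (f (t - r)%R * g r).

Lemma conv_ge0 f g t :
  (forall x, 0 <= f x) -> (forall x, 0 <= g x) -> 0 <= conv f g t.
Proof. by move=> f0 g0; apply: integral_ge0 => r _; exact: mule_ge0. Qed.

Let measurable_fun_kernel f g :
  measurable_fun setT f -> measurable_fun setT g ->
  measurable_fun setT (fun p : R * R => f (p.1 - p.2)%R * g p.2).
Proof.
move=> mf mg; apply: emeasurable_funM; last exact: measurableT_comp.
by apply: measurableT_comp => //; exact: measurable_funB.
Qed.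

Lemma measurable_conv f g :
  measurable_fun setT f -> measurable_fun setT g ->
  (forall x, 0 <= f x) -> (forall x, 0 <= g x) ->
  measurable_fun setT (conv f g).
Proof.
move=> mf mg f0 g0.
apply: (@measurable_fun_fubini_tonelli_F _ _ (measurableTypeR R)
  (measurableTypeR R) R mu (fun p => f (p.1 - p.2)%R * g p.2)).
  exact: measurable_fun_kernel.
by move=> p; exact: mule_ge0.
Qed.

(** Tonelli, then translation invariance of the inner integral. *)
Lemma integral_conv f g :
  measurable_fun setT f -> measurable_fun setT g ->
  (forall x, 0 <= f x) -> (forall x, 0 <= g x) ->
  \int[mu]_t conv f g t = \int[mu]_t f t * \int[mu]_t g t.
Proof.
move=> mf mg f0 g0.
rewrite /conv (@fubini_tonelli _ _ (measurableTypeR R)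
  (measurableTypeR R) R mu mu (fun p => f (p.1 - p.2)%R * g p.2))/=; last 2 first.
- exact: measurable_fun_kernel.
- by move=> p; exact: mule_ge0.
rewrite -ge0_integralZl//; last exact: integral_ge0.
apply: eq_integral => r _; rewrite ge0_integralZr//.
- by rewrite (ge0_integral_shift (- r) mf).
- by apply: measurableT_comp => //; exact: measurable_funB.
Qed.

(** Tonelli exchanges the two integrals, and translating the inner variable by [r] produces
    [conv f g (t - r)]. *)
Lemma convA f g h :
  measurable_fun setT f -> measurable_fun setT g -> measurable_fun setT h ->
  (forall x, 0 <= f x) -> (forall x, 0 <= g x) -> (forall x, 0 <= h x) ->
  conv f (conv g h) = conv (conv f g) h.
Proof.
move=> mf mg mh f0 g0 h0; apply/funext => t; rewrite /conv.
pose F (p : R * R) := f (t - p.1)%R * (g (p.1 - p.2)%R * h p.2).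
transitivity (\int[mu]_s \int[mu]_r F (s, r)).
  apply: eq_integral => s _; rewrite -ge0_integralZl//.
  - apply: emeasurable_funM => //.
    by apply: measurableT_comp => //; exact: measurable_funB.
  - by move=> r _; exact: mule_ge0.
rewrite (@fubini_tonelli _ _ (measurableTypeR R) (measurableTypeR R) R mu mu F)/=;
    last 2 first.
- apply: emeasurable_funM; last exact: measurable_fun_kernel.
  by apply: measurableT_comp => //; exact: measurable_funB.
- by move=> p; rewrite /F !mule_ge0.
apply: eq_integral => r _.
rewrite /F /=; under eq_integral do rewrite muleA.
have mfs : measurable_fun setT (fun s : R => f (t - s)%R * g (s - r)%R).
  by apply: emeasurable_funM;
    apply: measurableT_comp => //; exact: measurable_funB.
rewrite ge0_integralZr//; last by move=> s _; exact: mule_ge0.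
congr (_ * _); rewrite -(ge0_integral_shift r mfs); last first.
  by move=> s; exact: mule_ge0.
by apply: eq_integral => s _; rewrite addrK opprD addrA addrAC.
Qed.

End Convolution.

(** * The Gamma and Beta integrals *)

Section PowerKernel.
Context {R : realType}.
Local Notation mu := (@lebesgue_measure R).
Implicit Types a b t x : R.

Lemma continuous_powR a x : 0 < x -> {for x, continuous (@powR R ^~ a)}.
Proof.
move=> x0; apply: differentiable_continuous; apply/derivable1_diffP.
by apply: derivable_powR; rewrite in_itv/= andbT.
Qed.

(** For [a < 1] the integrand is singular at 0, so the fundamental theorem of calculus is applied on
    [[1/(n+2), 1]] and monotone convergence gives the limit. *)
Lemma integral_powR01 a : 0 < a ->
  (\int[mu]_(x in `]0%R, 1%R[) (x `^ (a - 1))%:E = (a^-1)%:E)%E.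
Proof.
move=> a0.
have mp D : measurable_fun D (EFin \o (fun x : R => x `^ (a - 1))).
  by apply/measurable_EFinP; apply: measurable_funTS; exact: measurable_powR.
(* Starting from 1/2 keeps every interval nondegenerate, including the one for [n = 0]. *)
pose F n : set R := `[n.+2%:R^-1, 1]%classic.
have itvE : `]0%R, 1%R]%classic = \bigcup_n F n.
  apply/seteqP; split=> x /=; rewrite in_itv/=.
    move=> /andP[x0 x1]; exists (Num.truncn x^-1) => //=.
    rewrite /F /= in_itv/= x1 andbT invf_ple ?posrE//.
    by rewrite (le_trans (ltW (truncnS_gt _)))// ler_nat.
  by move=> [n _]; rewrite /F/= in_itv/= => /andP[nx ->]; rewrite (lt_le_trans _ nx).
rewrite integral_itv_bndo_bndc// itvE.
have intF n : (\int[mu]_(x in F n) (x `^ (a - 1))%:E =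
    (a^-1 * (1 - n.+2%:R^-1 `^ a))%:E)%E.
  have n1 : n.+2%:R^-1 < 1 :> R by rewrite invf_lt1// ltr1n.
  have gt0 x : x \in `[n.+2%:R^-1, 1] -> 0 < x.
    by rewrite in_itv/= => /andP[+ _]; apply: lt_le_trans.
  have gt0' x : x \in `]n.+2%:R^-1, 1[ -> 0 < x.
    by move=> xI; apply: gt0; exact: subset_itv_oo_cc.
  rewrite (@continuous_FTC2 _ _ (fun x => a^-1 * x `^ a))//.
  - by rewrite powR1 -EFinB mulrBr.
  - apply: continuous_in_subspaceT => x /set_mem/gt0 x0; exact: continuous_powR.
  - split.
    + move=> x /gt0' x0; apply: derivableM => //.
      by apply: derivable_powR; rewrite in_itv/= andbT.
    + apply: cvg_at_right_filter; apply: cvgM; first exact: cvg_cst.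
      exact: continuous_powR.
    + apply: cvg_at_left_filter; apply: cvgM; first exact: cvg_cst.
      exact: continuous_powR.
  - move=> x /gt0' x0; rewrite derive1Ml; last first.
      by apply: derivable_powR; rewrite in_itv/= andbT.
    by rewrite powR_derive1 ?in_itv/= ?andbT// mulKf ?gt_eqF.
have cvg1 : (\int[mu]_(x in F n) (x `^ (a - 1))%:E)%E @[n --> \oo] -->
    (\int[mu]_(x in \bigcup_n F n) (x `^ (a - 1))%:E)%E.
  apply: (@ge0_nondecreasing_set_cvg_integral _ (measurableTypeR R) R F
    (EFin \o (fun x : R => x `^ (a - 1))) mu).
  - apply/nondecreasing_seqP => n; rewrite subsetEset; apply: subset_itvr.
    by rewrite bnd_simp lef_pV2 ?posrE// ler_nat.
  - by move=> n; exact: measurable_itv.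
  - by move=> n; exact: mp.
  - by move=> n x _; rewrite /= lee_fin powR_ge0.
rewrite (funext intF) in cvg1.
apply: (cvg_unique (@ereal_hausdorff R) cvg1).
apply: cvg_EFin; first by near=> n.
rewrite -[X in _ --> X]mulr1; apply: cvgM; first exact: cvg_cst.
rewrite -[X in _ --> X]subr0; apply: cvgB; first exact: cvg_cst.
have /cvg_at_rightP/= := powR_cvg0 a0; apply.
split; first by move=> n; rewrite invr_gt0.
have := @cvg_harmonic R; rewrite -cvg_shiftS.
exact.
Unshelve. all: by end_near. Qed.

End PowerKernel.

(** If the integral were 0, [f] would vanish almost everywhere on [D], which would make [D] a null
    set. *)
Lemma integral_gt0 d (T : measurableType d) (R : realType)
    (m : {measure set T -> \bar R}) (D : set T) (f : T -> \bar R) :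
  measurable D -> measurable_fun D f -> (0 < m D)%E ->
  (forall x, D x -> (0 < f x)%E) -> (0 < \int[m]_(x in D) f x)%E.
Proof.
move=> mD mf mD0 f0; rewrite lt0e integral_ge0 ?andbT; last first.
  by move=> x /f0/ltW.
apply/eqP => intf0.
have /(ae_eq_integral_abs m mD mf) [A [mA A0 subA]] :
    (\int[m]_(x in D) `|f x| = 0)%E.
  rewrite -[RHS]intf0; apply: eq_integral => x /[!inE]/f0/ltW.
  exact: gee0_abs.
suff DA : D `<=` A by move: mD0; rewrite (subset_measure0 mD mA DA A0) ltxx.
move=> x Dx; apply: subA => /= /(_ Dx)/eqP; rewrite gt_eqF//; exact: f0.
Qed.

Section GammaBeta.
Context {R : realType}.
Local Notation mu := (@lebesgue_measure R).
Implicit Types a b t x : R.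

(** The Riemann-Liouville kernel without its factor [1 / Gamma a], cut off so that convolutions only
    see []0, t[]. *)
Definition pker a x : R := if 0 < x then x `^ (a - 1) else 0.

Lemma pker_ge0 a x : 0 <= pker a x.
Proof. by rewrite /pker; case: ifP => // _; exact: powR_ge0. Qed.

Lemma measurable_pker a : measurable_fun setT (pker a).
Proof.
by apply: measurable_fun_ifT; [exact: measurable_fun_ltr |
  exact: measurable_powR | exact: measurable_cst].
Qed.

Let measurable_epker a : measurable_fun setT (EFin \o pker a).
Proof. by apply/measurable_EFinP; exact: measurable_pker. Qed.

Let epker_ge0 a x : (0 <= (EFin \o pker a) x)%E.
Proof. by rewrite lee_fin pker_ge0. Qed.

Let measurable_expRN : measurable_fun setT (fun r : R => expR (- r)).
Proof. by apply: (measurableT_comp (@measurable_expR R)). Qed.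

(** Extended real versions of [Beta] and [Gamma], so that Tonelli identities can be stated before
    finiteness is known. *)
Definition eBeta a b : \bar R :=
  (\int[mu]_(r in `]0%R, 1%R[) (r `^ (a - 1) * (1 - r) `^ (b - 1))%:E)%E.

Definition eGamma a : \bar R :=
  (\int[mu]_(r in `]0%R, +oo[) (r `^ (a - 1) * expR (- r))%:E)%E.

Lemma eBeta_ge0 a b : (0 <= eBeta a b)%E.
Proof. by apply: integral_ge0 => r _; rewrite lee_fin mulr_ge0 ?powR_ge0. Qed.

Lemma eGamma_ge0 a : (0 <= eGamma a)%E.
Proof.
by apply: integral_ge0 => r _; rewrite lee_fin mulr_ge0 ?powR_ge0 ?expR_ge0.
Qed.

(** For [t > 0] substitute [r = t v] and collect the powers of [t]; [v] carries the exponent of the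
    second kernel, hence the order in [eBeta b a]. For [t <= 0] the cut-offs leave nothing. *)
Lemma conv_pker a b t :
  conv (EFin \o pker a) (EFin \o pker b) t = (eBeta b a * (pker (a + b) t)%:E)%E.
Proof.
rewrite /conv /eBeta {3}/pker; case: ifPn => [t0|]; last first.
  rewrite -leNgt => t0; rewrite mule0.
  apply: integral0_eq => r _ /=; rewrite -EFinM /pker.
  case: ltP => // tr; case: ltP; rewrite ?(mulr0,mul0r)// => r0.
  by move: tr; rewrite subr_gt0 => /(lt_trans r0); rewrite ltNge t0.
have tN0 : t != 0 by rewrite gt_eqF.
rewrite -(@ge0_integral_affine _ t 0 tN0); last 2 first.
- apply: emeasurable_funM => //.
  apply: (measurableT_comp (measurable_epker a)); exact: measurable_funB.
- by move=> r; exact: mule_ge0.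
rewrite gtr0_norm// [in RHS]integral_mkcond.
set B := (X in (integral _ _ X * _)%E).
have mB : measurable_fun setT B.
  apply/(measurable_restrictT _ (measurable_itv _)).
  apply/measurable_EFinP; apply: measurable_funTS; apply: measurable_funM.
    exact: measurable_powR.
  apply: (measurableT_comp (@measurable_powR R (a - 1))); exact: measurable_funB.
have B0 r : (0 <= B r)%E.
  by apply: erestrict_ge0 => x _; rewrite lee_fin mulr_ge0 ?powR_ge0.
transitivity (t%:E * \int[mu]_r ((t `^ (a - 1) * t `^ (b - 1))%:E * B r))%E.
  congr (_ * _)%E; apply: eq_integral => r _ /=.
  rewrite /B patchE mem_setE in_itv/= addr0.
  rewrite -!EFinM/= /pker -[X in X - t * r]mulr1 -mulrBr !pmulr_rgt0// subr_gt0.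
  case: (ltP 0 r) => r0/=; last by rewrite !mulr0 mule0.
  case: (ltP r 1) => r1/=; last by rewrite mul0r mule0.
  rewrite -EFinM; congr EFin.
  rewrite !powRM ?(ltW r0) ?(ltW t0) ?subr_ge0 ?ltW//; ring.
rewrite ge0_integralZl//; last by rewrite lee_fin mulr_ge0 ?powR_ge0.
rewrite muleA muleC -EFinM; congr (_ * _%:E)%E.
rewrite -powRD ?tN0 ?implybT// -[X in X * _]powRr1 ?ltW// -powRD ?tN0 ?implybT//.
by congr powR; ring.
Qed.

Lemma integral_pker_exp a :
  (\int[mu]_r (pker a r * expR (- r))%:E = eGamma a)%E.
Proof.
rewrite /eGamma [RHS]integral_mkcond; apply: eq_integral => r _.
rewrite patchE mem_setE in_itv/= andbT /pker; case: ifP => //.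
by rewrite mul0r.
Qed.

(** As [exp(-(t - r)) exp(-r) = exp(-t)], the damped kernels convolve to [exp(-t)] times the
    convolution of the plain ones; it remains to integrate in [t]. *)
Lemma eGammaM a b : (eGamma a * eGamma b = eBeta b a * eGamma (a + b))%E.
Proof.
have mk c : measurable_fun setT (fun r => (pker c r * expR (- r))%:E).
  apply/measurable_EFinP; apply: measurable_funM => //; exact: measurable_pker.
have k0 c r : (0 <= (pker c r * expR (- r))%:E)%E.
  by rewrite lee_fin mulr_ge0 ?pker_ge0 ?expR_ge0.
rewrite -3!integral_pker_exp -integral_conv// -ge0_integralZl//; last 2 first.
- exact: mk.
- exact: eBeta_ge0.
apply: eq_integral => t _.
rewrite EFinM muleA -conv_pker muleC /conv -ge0_integralZl//.
- apply: eq_integral => r _; rewrite -!EFinM; congr EFin.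
  rewrite mulrACA -expRD -opprD subrK; ring.
- apply: emeasurable_funM; last exact: measurable_epker.
  apply: (measurableT_comp (measurable_epker a)); exact: measurable_funB.
- by move=> r _; exact: mule_ge0.
Qed.

Lemma eBeta1r a : 0 < a -> eBeta a 1 = (a^-1)%:E.
Proof.
move=> a0; rewrite -integral_powR01//; apply: eq_integral => r _.
by rewrite subrr powRr0 mulr1.
Qed.

(** This is the total mass of the exponential density of rate 1. *)
Lemma eGamma1 : eGamma 1 = 1%E.
Proof.
rewrite /eGamma; under eq_integral do rewrite subrr powRr0 mul1r.
rewrite integral_itv_obnd_cbnd; last first.
  by apply/measurable_EFinP; apply: measurable_funTS; exact: measurable_expRN.
rewrite -[RHS](@integral_exponential_pdf R 1 ltr01) integral_mkcond.
apply: eq_integral => r _; rewrite /exponential_pdf !patchE.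
by case: ifP => // _; rewrite mul1r mulN1r.
Qed.

Lemma eGamma_gt0 a : (0 < eGamma a)%E.
Proof.
have D0 : (0 < mu `]0%R, +oo[)%E by rewrite lebesgue_measure_itv/= !ltry.
apply: (@integral_gt0 _ (measurableTypeR R)) => //.
- apply/measurable_EFinP; apply: measurable_funTS; apply: measurable_funM.
    exact: measurable_powR.
  exact: measurable_expRN.
- move=> x; rewrite /= in_itv/= andbT => x0.
  by rewrite lte_fin mulr_gt0 ?powR_gt0 ?expR_gt0.
Qed.

Lemma eBeta_gt0 a b : (0 < eBeta a b)%E.
Proof.
have D0 : (0 < mu `]0%R, 1%R[)%E.
  by rewrite lebesgue_measure_itv/= lte_fin ltr01 oppr0 adde0 lte_fin ltr01.
apply: (@integral_gt0 _ (measurableTypeR R)) => //.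
- apply/measurable_EFinP; apply: measurable_funTS; apply: measurable_funM.
    exact: measurable_powR.
  apply: (measurableT_comp (@measurable_powR R (b - 1))); exact: measurable_funB.
- move=> x; rewrite /= in_itv/= => /andP[x0 x1].
  by rewrite lte_fin mulr_gt0 ?powR_gt0 ?subr_gt0.
Qed.

(* On ]0, 1] compare with x^(c - 1) + exp(- x); beyond that, halving the
   argument in eGammaM propagates finiteness, since the Beta factor is not 0. *)
Lemma eGamma_lty a : 0 < a -> (eGamma a < +oo)%E.
Proof.
have eGamma_le1 c : 0 < c <= 1 -> (eGamma c < +oo)%E.
  move=> /andP[c0 c1]; rewrite -integral_pker_exp.
  apply: (@le_lt_trans _ _ (\int[mu]_(x in `]0%R, 1%R[) (x `^ (c - 1))%:E +
      eGamma 1)%E); last first.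
    by rewrite integral_powR01// eGamma1 ltry.
  rewrite -integral_pker_exp [X in (_ <= X + _)%E]integral_mkcond.
  have mP : measurable_fun setT
      ((fun x : R => (x `^ (c - 1))%:E) \_ `]0%R, 1%R[).
    apply/(measurable_restrictT _ (measurable_itv _)).
    by apply/measurable_EFinP; apply: measurable_funTS; exact: measurable_powR.
  have P0 x : (0 <= ((fun x : R => (x `^ (c - 1))%:E) \_ `]0%R, 1%R[) x)%E.
    by apply: erestrict_ge0 => y _; rewrite lee_fin powR_ge0.
  have mk d : measurable_fun setT (fun r => (pker d r * expR (- r))%:E).
    by apply/measurable_EFinP; apply: measurable_funM;
      [exact: measurable_pker | exact: measurable_expRN].
  have k0 d r : (0 <= (pker d r * expR (- r))%:E)%E.
    by rewrite lee_fin mulr_ge0 ?pker_ge0 ?expR_ge0.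
  rewrite -ge0_integralD//; last exact: mk.
  apply: ge0_le_integral => //.
  - exact: mk.
  - by apply: emeasurable_funD; [exact: mP | exact: mk].
  move=> x _; rewrite patchE mem_setE in_itv/= /pker.
  case: ifPn => x0/=; last by rewrite !mul0r add0e.
  have [x1|x1] := ltP x 1.
    rewrite -EFinD lee_fin subrr powRr0 mul1r ler_wpDr ?expR_ge0//.
    by rewrite ler_piMr ?powR_ge0// -expR0 ler_expR oppr_le0 ltW.
  by rewrite add0e lee_fin ler_wpM2r ?expR_ge0// ler_powR// lerD2r.
(* Halving sends []0, n+2]] into []0, n+1]], which drives the induction from the base interval []0,
   1]]. *)
have bounded n : forall c, 0 < c <= n.+1%:R -> (eGamma c < +oo)%E.
  elim: n => [//|n IH] c /andP[c0 cn].
  have lty2 : (eGamma (c / 2) < +oo)%E.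
    apply: IH; rewrite divr_gt0//= ler_pdivrMr// (le_trans cn)//.
    by rewrite -natrM ler_nat muln2 -addnn addSnnS leq_addl.
  rewrite ltey; apply/eqP => cy; have := eGammaM (c / 2) (c / 2).
  rewrite -splitr cy gt0_muley ?eBeta_gt0// => ey.
  have := lte_mul_pinfty (eGamma_ge0 (c / 2)) _ lty2.
  by rewrite ey ltxx ge0_fin_numE ?eGamma_ge0// => /(_ lty2).
move=> a0; apply: (bounded (Num.truncn a)).
by rewrite a0 ltW// truncnS_gt.
Qed.

Lemma eGammaE a : 0 < a -> eGamma a = (Gamma a)%:E.
Proof.
by move=> a0; rewrite [RHS]fineK// ge0_fin_numE ?eGamma_ge0 ?eGamma_lty.
Qed.

Lemma Gamma_gt0 a : 0 < a -> 0 < Gamma a.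
Proof. by move=> a0; rewrite -lte_fin -eGammaE ?eGamma_gt0. Qed.

(** An infinite Beta integral times a positive Gamma value would make the finite product of Gamma
    values infinite. *)
Lemma eBetaE a b : 0 < a -> 0 < b -> eBeta a b = (Beta a b)%:E.
Proof.
move=> a0 b0; have By : (eBeta a b < +oo)%E.
  rewrite ltey; apply/eqP => By; have := eGammaM b a.
  by rewrite By gt0_mulye ?eGamma_gt0// !eGammaE.
by rewrite [RHS]fineK// ge0_fin_numE ?eBeta_ge0.
Qed.

Lemma BetaE a b : 0 < a -> 0 < b -> Beta a b = Gamma a * Gamma b / Gamma (a + b).
Proof.
move=> a0 b0; have ab0 : 0 < a + b by rewrite addr_gt0.
have := eGammaM b a; rewrite !eGammaE ?eBetaE 1?addrC// -!EFinM => -[E].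
by rewrite (mulrC (Gamma a)) E mulfK// gt_eqF// Gamma_gt0.
Qed.

Lemma Gamma1 : Gamma 1 = 1 :> R.
Proof. by apply: EFin_inj; rewrite -eGammaE// eGamma1. Qed.

(** Compare the direct value [1/a] of [Beta a 1] with its expression through Gamma. *)
Lemma GammaS a : 0 < a -> Gamma (a + 1) = a * Gamma a.
Proof.
move=> a0; have := BetaE a0 ltr01.
rewrite /Beta /Rintegral -/(eBeta a 1) eBeta1r// Gamma1 mulr1/= => E.
have : Gamma (a + 1) != 0 by rewrite gt_eqF// Gamma_gt0// addr_gt0.
move=> G0; apply: (mulIf (invr_neq0 (lt0r_neq0 a0))).
by rewrite mulrAC mulfV ?gt_eqF// mul1r E mulrC mulfVK.
Qed.

End GammaBeta.

(** * Riemann-Liouville integrals *)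

Section FractionalIntegral.
Context {R : realType}.
Local Notation mu := (@lebesgue_measure R).
Implicit Types (a b c t x : R) (g h : R -> R).

(* The Riemann-Liouville integral of order b based at 0. Since ]0, t[ is empty
   for t <= 0, it is automatically extended by 0 to the left of 0. *)
Definition fint b g t : R :=
  (Gamma b)^-1 * \int[mu]_(r in `]0, t[) ((t - r) `^ (b - 1) * g r).

(** This cut-off turns an integral over []0, t[] into a convolution on the whole line. *)
Definition tpos g x : R := if 0 < x then g x else 0.

Lemma fint_le0 b g t : t <= 0 -> fint b g t = 0.
Proof.
by move=> t0; rewrite /fint set_itv_ge ?Rintegral_set0 ?mulr0// bnd_simp -leNgt.
Qed.

Lemma eq_fint b g h t :
  (forall r, 0 < r < t -> g r = h r) -> fint b g t = fint b h t.
Proof.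
move=> gh; congr (_ * _); apply: eq_Rintegral => r; rewrite mem_setE in_itv/=.
by move=> /gh ->.
Qed.

Lemma continuous_itv_bounded g a b : continuous g ->
  exists2 M, 0 <= M & forall x, a <= x <= b -> `|g x| <= M.
Proof.
move=> cg; have [ab|ba] := leP a b; last first.
  exists 0 => // x /andP[ax xb].
  by move: ba; rewrite ltNge (le_trans ax xb).
have cng : {within `[a, b], continuous (fun x => `|g x|)}.
  apply: continuous_subspaceT => x.
  by apply: continuous_comp; [exact: cg | exact: norm_continuous].
have [c _ cM] := EVT_max ab cng.
by exists `|g c| => // x xab; apply: cM; rewrite in_itv.
Qed.

Lemma integral_fint_conv b g t :
  (\int[mu]_(r in `]0%R, t[) ((t - r) `^ (b - 1) * g r)%:E)%E =
  conv (EFin \o pker b) (EFin \o tpos g) t.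
Proof.
rewrite integral_mkcond; apply: eq_integral => r _.
rewrite patchE mem_setE in_itv/= /pker /tpos subr_gt0 -EFinM andbC.
by case: (ltP r t) => /=; case: (ltP 0 r) => /=; rewrite ?(mulr0, mul0r).
Qed.

Lemma tpos1 x : tpos (cst 1) x = pker 1 x.
Proof. by rewrite /tpos /pker subrr powRr0. Qed.

(** The constant 1, cut off at 0, is the power kernel of order 1, so this is a case of
    [conv_pker]. *)
Lemma fint1 b t : 0 < b -> 0 <= t -> fint b (cst 1) t = t `^ b / Gamma (b + 1).
Proof.
move=> b0; rewrite le_eqVlt => /predU1P[<-|t0].
  by rewrite fint_le0// powR0 ?gt_eqF// mul0r.
rewrite /fint /Rintegral integral_fint_conv.
rewrite (_ : EFin \o tpos (cst 1) = EFin \o pker 1); last first.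
  by apply/funext => x /=; rewrite tpos1.
rewrite conv_pker eBetaE// BetaE// Gamma1 mul1r /pker t0 addrK (addrC 1).
by rewrite mulrA mulrA mulVf ?gt_eqF ?Gamma_gt0// mul1r mulrC.
Qed.

Lemma measurable_fint_integrand b g t : continuous g ->
  measurable_fun setT (fun r : R => (t - r) `^ (b - 1) * g r).
Proof.
move=> cg; apply: measurable_funM; last exact: continuous_measurable_fun.
apply: (measurableT_comp (@measurable_powR R (b - 1))).
exact: measurable_funB.
Qed.

(** The kernel is integrable, with a finite Beta integral, and [g] is bounded on [[0, t]]. *)
Lemma integrable_fint b g t : 0 < b -> continuous g ->
  mu.-integrable `]0, t[ (EFin \o (fun r => (t - r) `^ (b - 1) * g r)).
Proof.
move=> b0 cg.
have [M M0 gM] := continuous_itv_bounded 0 t cg.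
pose k (r : R) := (t - r) `^ (b - 1).
have -> : EFin \o (fun r => (t - r) `^ (b - 1) * g r) =
  ((EFin \o k) \* (EFin \o g))%E by [].
have mk : measurable_fun setT k.
  apply: (measurableT_comp (@measurable_powR R (b - 1))).
  exact: measurable_funB.
apply: integrableMl => //.
- apply/integrableP; split.
    by apply: measurable_funTS; exact/measurable_EFinP.
  under eq_integral => r _ do rewrite /= /k ger0_norm ?powR_ge0//
    -[X in X%:E]mulr1 -[X in _ * X]/(cst 1 r).
  rewrite integral_fint_conv (_ : EFin \o tpos (cst 1) = EFin \o pker 1).
    by rewrite conv_pker eBetaE// -EFinM ltry.
  by apply/funext => x /=; rewrite tpos1.
- by apply: measurable_funTS; exact: continuous_measurable_fun.
- exists M; split; first exact: num_real.
  move=> N MN r; rewrite /= in_itv/= => /andP[r0 rt].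
  by apply: le_trans (ltW MN); apply: gM; rewrite !ltW.
Qed.

Lemma fintD b g h t : 0 < b -> continuous g -> continuous h ->
  fint b (fun r => g r + h r) t = fint b g t + fint b h t.
Proof.
move=> b0 cg ch; rewrite /fint -mulrDr; congr (_ * _).
rewrite -RintegralD//; [|exact: integrable_fint..].
by apply: eq_Rintegral => r _; rewrite mulrDr.
Qed.

Lemma fintZ b c g t : 0 < b -> continuous g ->
  fint b (fun r => c * g r) t = c * fint b g t.
Proof.
move=> b0 cg; rewrite /fint mulrCA; congr (_ * _).
rewrite -RintegralZl//; last exact: integrable_fint.
by apply: eq_Rintegral => r _; rewrite mulrCA.
Qed.

Lemma fintB b g h t : 0 < b -> continuous g -> continuous h ->
  fint b (fun r => g r - h r) t = fint b g t - fint b h t.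
Proof.
move=> b0 cg ch; rewrite -[- fint b h t]mulN1r -fintZ// -fintD//.
  by apply: eq_fint => r _; rewrite mulN1r.
by move=> x; apply: cvgM; [exact: cvg_cst | exact: ch].
Qed.

Lemma measurable_fint_patch b g t (I : interval R) : continuous g ->
  measurable_fun setT
    ((fun r : R => ((t - r) `^ (b - 1) * g r)%:E) \_ [set` I]).
Proof.
move=> cg; apply/(measurable_restrictT _ (measurable_itv _)).
apply: measurable_funTS; apply/measurable_EFinP.
exact: measurable_fint_integrand.
Qed.

(** Since [g] vanishes left of 0, the delayed integrand only starts at [c], and a translation brings
    it back to 0. *)
Lemma fint_shift b g c t : continuous g -> 0 <= c ->
  (forall x, x <= 0 -> g x = 0) ->
  fint b (fun r => g (r - c)) t = fint b g (t - c).
Proof.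
move=> cg c0 g0; rewrite /fint /Rintegral; congr (_ * fine _).
rewrite [LHS]integral_mkcond [RHS]integral_mkcond.
rewrite -(integral_shift (- c) (measurable_fint_patch b (t - c) `]0, (t - c)[ cg)).
apply: eq_integral => r _; rewrite !patchE !mem_setE !in_itv/= subr_gt0 ltrD2r.
have [rc|cr] := leP r c.
  by rewrite g0 ?subr_le0// mulr0 if_same.
by rewrite (le_lt_trans c0 cr)/= opprB addrA subrK.
Qed.

(** Moves [t] from the singular kernel to the continuous factor, as dominated convergence in [t]
    requires. *)
Lemma fint_reflect b g t : continuous g ->
  fint b g t = (Gamma b)^-1 * \int[mu]_(r in `]0, t[) (r `^ (b - 1) * g (t - r)).
Proof.
move=> cg; rewrite /fint /Rintegral; congr (_ * fine _).
rewrite [LHS]integral_mkcond [RHS]integral_mkcond.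
rewrite -(integral_reflect t (measurable_fint_patch b t `]0, t[ cg)).
apply: eq_integral => r _; rewrite !patchE !mem_setE !in_itv/= subr_gt0.
by rewrite ltrBlDr ltrDl andbC subKr.
Qed.

End FractionalIntegral.

(** * Continuity and semigroup law of fractional integrals *)

Section FractionalIntegralContinuity.
Context {R : realType}.
Local Notation mu := (@lebesgue_measure R).
Implicit Types (a b c t x : R) (g h : R -> R).

Lemma integrable_powR b t : 0 < b ->
  mu.-integrable `]0, t[ (EFin \o (fun r => r `^ (b - 1))).
Proof.
move=> b0; apply/integrableP; split.
  by apply: measurable_funTS; apply/measurable_EFinP; exact: measurable_powR.
(* The power is written with an extra factor [(t - r)^0], the kernel of order 1, to reduce to
   [conv_pker]. *)
under eq_integral => r _ do rewrite /= ger0_norm ?powR_ge0//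
  -[X in X%:E]mul1r -[X in X * _](powRr0 (t - r)) -[X in _ `^ X](subrr 1).
rewrite integral_fint_conv.
rewrite (_ : EFin \o tpos _ = EFin \o pker b) ?conv_pker ?eBetaE -?EFinM ?ltry//.
Qed.

(** As [h] vanishes left of 0, the reflected integral extends to a fixed interval []0, T[], where
    [M s^(b-1)] dominates the integrand uniformly in [t]. *)
Let fint_continuous0 b h : 0 < b -> continuous h ->
  (forall x, x <= 0 -> h x = 0) -> continuous (fint b h).
Proof.
move=> b0 ch h0 t0; pose T := `|t0| + 1.
have T0 : 0 < T by rewrite ltr_wpDl.
(* For [t] in []-T, T[] and [s] in []0, T[], the argument [t - s] stays in [[-2T, T]]. *)
have [M M0 hM] := continuous_itv_bounded (- (T + T)) T ch.
pose f (t s : R) := s `^ (b - 1) * h (t - s).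
have fintE t : t < T ->
    fint b h t = (Gamma b)^-1 * \int[mu]_(s in `]0, T[) f t s.
  move=> tT; rewrite fint_reflect// /Rintegral; congr (_ * fine _).
  rewrite [LHS]integral_mkcond [RHS]integral_mkcond.
  apply: eq_integral => r _; rewrite !patchE !mem_setE !in_itv/= /f.
  case: (ltP r t) => [rt|tr].
    by rewrite (lt_trans rt tT).
  by rewrite andbF h0 ?subr_le0// mulr0 if_same.
have t0T : t0 \in `](- T), T[.
  by rewrite in_itv/= -ltr_norml ltrDl.
have hb t s : `](- T), T[%classic t -> `]0, T[%classic s -> `|h (t - s)| <= M.
  rewrite /= !in_itv/= => /andP[t1 t2] /andP[s1 s2]; apply: hM.
  by apply/andP; split; lra.
have mf t : measurable_fun `]0, T[ (f t).
  apply: measurable_funTS; apply: measurable_funM; first exact: measurable_powR.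
  apply: (measurableT_comp (continuous_measurable_fun ch)).
  exact: measurable_funB.
have ig : mu.-integrable `]0, T[ (EFin \o (fun s => M * s `^ (b - 1))).
  have := @integrableZl _ (measurableTypeR R) R mu _ (measurable_itv _) M _
    (integrable_powR T b0).
  by apply: eq_integrable => // s _ /=; rewrite EFinM.
have fb t s : `](- T), T[%classic t -> `]0, T[%classic s ->
    `|f t s| <= M * s `^ (b - 1).
  move=> tI sI; rewrite /f normrM ger0_norm ?powR_ge0// mulrC.
  by rewrite ler_wpM2r ?powR_ge0// hb.
have cF := @continuity_under_integral R _ (measurableTypeR R) mu f `]0, T[%classic
  (measurable_itv _) (- T) T _ _ _ ig.
have {}cF : {for t0, continuous (fun t => \int[mu]_(s in `]0, T[) f t s)}.
  apply: cF.
  - move=> t tI; apply: (@le_integrable _ (measurableTypeR R) R mu _ (measurable_itv _)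
      _ _ _ _ ig) => //.
      by apply/measurable_EFinP; exact: mf.
    move=> s sI; rewrite /= lee_fin [leRHS]ger0_norm ?fb//.
    by rewrite mulr_ge0 ?powR_ge0.
  - apply: aeW => s _ t _; apply: cvgM; first exact: cvg_cst.
    apply: continuous_comp; last exact: ch.
    by apply: cvgB; [exact: cvg_id | exact: cvg_cst].
  - by move=> t tI; apply: aeW => s; exact: fb.
  - by rewrite inE.
have cG : {for t0, continuous
    (fun t => (Gamma b)^-1 * \int[mu]_(s in `]0, T[) f t s)}.
  by apply: cvgM; [exact: cvg_cst | exact: cF].
rewrite /continuous_at fintE; last by move: t0T; rewrite in_itv/= => /andP[].
apply: cvg_trans cG; apply: near_eq_cvg; near=> t; rewrite fintE//.
near: t; apply: lt_nbhsl.
by move: t0T; rewrite in_itv/= => /andP[].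
Unshelve. all: by end_near. Qed.

Lemma continuous_max0 : continuous (fun x : R => Num.max x 0).
Proof.
under eq_fun do rewrite Num.Theory.maxr_absE.
move=> x; apply: cvgM; last exact: cvg_cst.
apply: cvgD; first by apply: cvgD; [exact: cvg_id | exact: cvg_cst].
by apply: cvg_norm; apply: cvgB; [exact: cvg_id | exact: cvg_cst].
Qed.

Lemma continuous_fint1 b : 0 < b -> continuous (fint b (cst 1)).
Proof.
move=> b0 t; rewrite /continuous_at; have [t0|t0|->] := ltgtP t 0.
- rewrite fint_le0 ?ltW//; apply: cvg_near_cst; near=> s.
  rewrite fint_le0// ltW//; near: s; exact: lt_nbhsl.
- rewrite fint1 ?ltW//.
  have cp : s `^ b / Gamma (b + 1) @[s --> t] --> t `^ b / Gamma (b + 1).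
    by apply: cvgM; [exact: continuous_powR | exact: cvg_cst].
  apply: cvg_trans cp; apply: near_eq_cvg; near=> s; rewrite fint1// ltW//.
  near: s; exact: lt_nbhsr.
(* At 0 the zero branch meets the power branch, which tends to 0 because [b > 0]. *)
- apply/left_right_continuousP; rewrite fint_le0//; split.
    apply: cvg_near_cst; apply: filterS (nbhs_left_lt (0 : R)) => s s0.
    by rewrite fint_le0// ltW.
  have cp : s `^ b / Gamma (b + 1) @[s --> 0^'+] --> 0.
    rewrite -[X in _ --> X](mul0r (Gamma (b + 1))^-1).
    by apply: cvgM; [exact: powR_cvg0 | exact: cvg_cst].
  apply: cvg_trans cp; apply: near_eq_cvg.
  apply: filterS (nbhs_right_gt (0 : R)) => s s0.
  by rewrite fint1// ltW.
Unshelve. all: by end_near. Qed.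

(* Splitting off the value g 0 leaves a function that stays continuous when
   extended by 0, for which dominated convergence applies. *)
Lemma fint_continuous b g : 0 < b -> continuous g -> continuous (fint b g).
Proof.
move=> b0 cg; pose h x := g (Num.max x 0) - g 0.
have ch : continuous h.
  move=> x; apply: cvgB; last exact: cvg_cst.
  by apply: continuous_comp; [exact: continuous_max0 | exact: cg].
have h0 x : x <= 0 -> h x = 0 by move=> x0; rewrite /h max_r// subrr.
have -> : fint b g = (fun t => g 0 * fint b (cst 1) t + fint b h t).
  apply/funext => t; rewrite -fintZ//; last by move=> ?; exact: cvg_cst.
  rewrite -fintD//; last by move=> ?; apply: cvgM; exact: cvg_cst.
  apply: eq_fint => r /andP[r0 _].
  by rewrite mulr1 /h max_l ?ltW// addrC subrK.
move=> t; apply: cvgD; last exact: fint_continuous0.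
by apply: cvgM; [exact: cvg_cst | exact: continuous_fint1].
Qed.

(** Associativity of convolution merges the two kernels into one of order [a + b]; the resulting
    [Beta b a] cancels against the Gamma normalizations. *)
Let fint_fint_ge0 a b g t : 0 < a -> 0 < b -> continuous g ->
  (forall x, 0 <= g x) -> fint a (fint b g) t = fint (a + b) g t.
Proof.
move=> a0 b0 cg g0.
have ab0 : 0 < a + b by rewrite addr_gt0.
have mk c : measurable_fun setT (EFin \o pker c).
  by apply/measurable_EFinP; exact: measurable_pker.
have k0 c x : (0 <= (EFin \o pker c) x)%E by rewrite lee_fin pker_ge0.
have tg0 x : (0 <= (EFin \o tpos g) x)%E.
  by rewrite lee_fin /tpos; case: ifP.
have mtg : measurable_fun setT (EFin \o tpos g).
  apply/measurable_EFinP; apply: measurable_fun_ifT;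
    [exact: measurable_fun_ltr | exact: continuous_measurable_fun
    | exact: measurable_cst].
have fintE c x : 0 < c ->
    conv (EFin \o pker c) (EFin \o tpos g) x = (Gamma c * fint c g x)%:E.
  move=> c0; rewrite /fint mulVKf ?gt_eqF ?Gamma_gt0//.
  rewrite -integral_fint_conv [RHS]fineK//.
  apply: integrable_fin_num => //; exact: integrable_fint.
(* The cut-off changes nothing here, since [fint b g] already vanishes on [x <= 0]. *)
have E : EFin \o tpos (fint b g) =
    (fun x => (Gamma b)^-1%:E * conv (EFin \o pker b) (EFin \o tpos g) x)%E.
  apply/funext => x; rewrite fintE// -EFinM mulKf ?gt_eqF ?Gamma_gt0//.
  by rewrite /= /tpos; case: ltP => // x0; rewrite fint_le0.
rewrite {1}/fint /Rintegral integral_fint_conv E /conv.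
under eq_integral do rewrite muleCA.
rewrite ge0_integralZl//; last 3 first.
- apply: emeasurable_funM; last exact: measurable_conv.
  apply: (measurableT_comp (mk a)); exact: measurable_funB.
- by move=> x _; apply: mule_ge0 => //; exact: conv_ge0.
- by rewrite lee_fin invr_ge0 ltW// Gamma_gt0.
rewrite -/(conv _ (conv _ _) t) convA// (_ : conv (EFin \o pker a) _ =
    (fun x => (Beta b a)%:E * (EFin \o pker (a + b)) x)%E); last first.
  by apply/funext => x; rewrite conv_pker eBetaE.
rewrite /conv; under eq_integral do rewrite -muleA.
rewrite ge0_integralZl//; last 3 first.
- apply: emeasurable_funM; last exact: mtg.
  apply: (measurableT_comp (mk (a + b))); exact: measurable_funB.
- by move=> x _; exact: mule_ge0.
- by rewrite -eBetaE// eBeta_ge0.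
rewrite -/(conv _ _ t) fintE// -!EFinM/= BetaE// (addrC b).
have := lt0r_neq0 (Gamma_gt0 a0); have := lt0r_neq0 (Gamma_gt0 b0).
have := lt0r_neq0 (Gamma_gt0 ab0).
move: (Gamma a) (Gamma b) (Gamma (a + b)) (fint _ _ _) => x y z w z0 y0 x0.
by field; rewrite x0 y0 z0.
Qed.

(** The positive and negative parts of [g] are continuous, so linearity reduces to the nonnegative
    case. *)
Lemma fint_fint a b g t : 0 < a -> 0 < b -> continuous g ->
  fint a (fint b g) t = fint (a + b) g t.
Proof.
move=> a0 b0 cg; have ab0 : 0 < a + b by rewrite addr_gt0.
pose gp x := Num.max (g x) 0; pose gn x := Num.max (- g x) 0.
have cgp : continuous gp.
  move=> x; apply: (@continuous_comp _ _ _ g (Num.max^~ 0)); first exact: cg.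
  exact: continuous_max0.
have cgn : continuous gn.
  move=> x; apply: (@continuous_comp _ _ _ (fun y => - g y) (Num.max^~ 0)).
    by apply: cvgN; exact: cg.
  exact: continuous_max0.
have gp0 x : 0 <= gp x by rewrite /gp le_max lexx orbT.
have gn0 x : 0 <= gn x by rewrite /gn le_max lexx orbT.
have -> : g = (fun x => gp x - gn x).
  apply/funext => x; rewrite /gp /gn; have /orP[g0|g0] := le_total 0 (g x).
    by rewrite max_l// max_r ?oppr_le0// subr0.
  by rewrite max_r// max_l ?oppr_ge0// sub0r opprK.
rewrite (_ : fint b _ = (fun x => fint b gp x - fint b gn x)); last first.
  by apply/funext => x; exact: fintB.
by rewrite !fintB ?fint_fint_ge0//; exact: fint_continuous.
Qed.

End FractionalIntegralContinuity.

(** * Fractional integrals of shifted powers and the incomplete Beta function *)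

Section ShiftedPower.
Context {R : realType}.
Local Notation mu := (@lebesgue_measure R).
Implicit Types (a b c s t x : R) (g h : R -> R).

(** For infinite [x] both sides are 0: the product is 0 or infinite, and [fine] sends infinities to
    0. *)
Lemma fine_EFinM (k : R) (x : \bar R) : fine (k%:E * x)%E = k * fine x.
Proof.
case: x => [r| |]; first by [].
  rewrite [RHS]mulr0 mulry.
  by case: (sgrP k) => _; [rewrite mul0e | rewrite mul1e | rewrite mulN1e].
rewrite [RHS]mulr0 mulrNy.
by case: (sgrP k) => _; [rewrite mul0e | rewrite mul1e | rewrite mulN1e].
Qed.

(** The lower end [d] is left free: it is [- tau] for the Caputo derivative of the history and 0 for
    shifted powers. *)
Lemma Rintegral_fint_shift b c d g t : continuous g ->
  \int[mu]_(r in `]d, t[) ((t - r) `^ (b - 1) * g (r + c)) =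
  \int[mu]_(r in `](d + c), (t + c)[) ((t + c - r) `^ (b - 1) * g r).
Proof.
move=> cg; rewrite /Rintegral; congr fine.
rewrite [LHS]integral_mkcond [RHS]integral_mkcond.
rewrite -(integral_shift c (measurable_fint_patch b (t + c)
  `](d + c), (t + c)[ cg)).
apply: eq_integral => r _; rewrite !patchE !mem_setE !in_itv/= !ltrD2r.
by rewrite opprD addrACA subrr addr0.
Qed.

Lemma continuous_shift g c : continuous g -> continuous (fun x => g (x + c)).
Proof.
move=> cg x; apply: (@continuous_comp _ _ _ (fun y => y + c) g); last exact: cg.
by apply: cvgD; [exact: cvg_id | exact: cvg_cst].
Qed.

(** Substitute [r = T v]; [c <= T] keeps [1 - v] nonnegative, so the powers factor. *)
Let integral_power_scale a b T c : 0 < T -> c <= T ->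
  \int[mu]_(r in `]0, c[) ((T - r) `^ (b - 1) * r `^ a) =
  T `^ (a + b) * \int[mu]_(v in `]0, c / T[) (v `^ a * (1 - v) `^ (b - 1)).
Proof.
move=> T0 cT; rewrite /Rintegral -fine_EFinM; congr fine.
have TN0 : T != 0 by rewrite gt_eqF.
have mb (k : R) : measurable_fun setT (fun v : R => (k - v) `^ (b - 1)).
  apply: (measurableT_comp (@measurable_powR R (b - 1))).
  exact: measurable_funB.
rewrite [LHS]integral_mkcond [in RHS]integral_mkcond.
rewrite -[LHS](@ge0_integral_affine _ T 0 TN0); last 2 first.
- apply/(measurable_restrictT _ (measurable_itv _)); apply: measurable_funTS.
  by apply/measurable_EFinP; apply: measurable_funM;
    [exact: mb | exact: measurable_powR].
- by move=> x; apply: erestrict_ge0 => y _; rewrite lee_fin mulr_ge0 ?powR_ge0.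
rewrite (gtr0_norm T0).
set B := (X in (_ = _ * integral _ _ X)%E).
have mB : measurable_fun setT B.
  apply/(measurable_restrictT _ (measurable_itv _)); apply: measurable_funTS.
  by apply/measurable_EFinP; apply: measurable_funM;
    [exact: measurable_powR | exact: mb].
have B0 x : (0 <= B x)%E.
  by apply: erestrict_ge0 => y _; rewrite lee_fin mulr_ge0 ?powR_ge0.
have TE : T * (T `^ (b - 1) * T `^ a) = T `^ (a + b).
  rewrite -powRD ?TN0 ?implybT// -[X in X * _](powRr1 (ltW T0)).
  by rewrite -powRD ?TN0 ?implybT//; congr powR; ring.
transitivity (T%:E * \int[mu]_v ((T `^ (b - 1) * T `^ a)%:E * B v))%E.
  congr (_ * _)%E; apply: eq_integral => v _.
  rewrite /B !patchE !mem_setE !in_itv/= addr0 pmulr_rgt0// ltr_pdivlMr//.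
  rewrite (mulrC v); case: ifPn => [/andP[v0 vc]|_]; last by rewrite mule0.
  rewrite -EFinM; congr EFin.
  have v1 : v <= 1.
    by rewrite -(ler_pM2l T0) mulr1 (le_trans (ltW vc)).
  rewrite -[X in X - T * v]mulr1 -mulrBr.
  rewrite (powRM _ (ltW T0) (ltW v0)) powRM ?(ltW T0) ?subr_ge0//; ring.
rewrite ge0_integralZl//; last by rewrite lee_fin mulr_ge0 ?powR_ge0.
by rewrite muleA -EFinM TE.
Qed.

(** After translation this is the part over []c, s + c[] of the integral defining
    [J^b J^a 1 (s + c)]; the part over []0, c[] is the incomplete Beta term that gets subtracted. *)
Lemma fint_shifted_power a b s c : 0 < a -> 0 < b -> 0 <= s -> 0 < c ->
  fint b (fun r => fint a (cst 1) (r + c)) s =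
  (s + c) `^ (a + b) / Gamma (a + b + 1) *
    (1 - reg_inc_beta (c / (s + c)) (a + 1) b).
Proof.
move=> a0 b0 s0 c0; have T0 : 0 < s + c by rewrite ltr_wpDl.
have ab0 : 0 < a + b by rewrite addr_gt0.
have c1 : continuous (fint a (cst 1)) := continuous_fint1 a0.
have gt0 x : 0 < x -> Gamma x != 0 by move=> x0; rewrite gt_eqF// Gamma_gt0.
have a10 : 0 < a + 1 by rewrite addr_gt0.
have B0 : Beta (a + 1) b != 0.
  by rewrite BetaE// !mulf_neq0 ?invr_eq0 ?gt0 ?addr_gt0.
(* For [s = 0] both sides are 0, because [c / (0 + c) = 1] and the regularized function equals 1
   there. *)
move: s0; rewrite le_eqVlt => /predU1P[<-|s0].
  rewrite fint_le0// add0r divff ?gt_eqF// /reg_inc_beta.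
  by rewrite mulVf// subrr mulr0.
(* The integral over all of []0, s + c[], by the semigroup law. *)
have := fint_fint (s + c) b0 a0 (fun x => @cst_continuous _ _ (1 : R) x).
rewrite fint1 ?addr_gt0// ?(ltW T0)// {1}/fint => E.
have bnd1 : (BRight (0 : R) <= BRight c)%O by rewrite bnd_simp ltW.
have bnd2 : (BRight c <= BLeft (s + c))%O by rewrite bnd_simp ltrDr.
have intT := integrable_fint (s + c) b0 c1.
have := Rintegral_itvB intT bnd1 bnd2.
rewrite -Rintegral_itv_bndo_bndc; last first.
  apply: integrableS intT => //; apply: subset_itvl.
  by rewrite bnd_simp ltW// ltrDr.
have /= := Rintegral_fint_shift b c 0 s c1; rewrite add0r => <-.
have intc : mu.-integrable `]0, c[
    (EFin \o (fun r : R => (s + c - r) `^ (b - 1) * fint a (cst 1) r)).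
  by apply: integrableS intT => //; apply: subset_itvl; rewrite bnd_simp ltW ?ltrDr.
have -> : \int[mu]_(x in `]0, c[) ((s + c - x) `^ (b - 1) * fint a (cst 1) x) =
    (Gamma (a + 1))^-1 * ((s + c) `^ (a + b) *
      (Beta (a + 1) b * reg_inc_beta (c / (s + c)) (a + 1) b)).
  apply: (mulfI (gt0 _ a10)); rewrite mulVKf ?gt0// -RintegralZl//.
  rewrite mulVKf// addrK -integral_power_scale ?ltW ?ltrDr//.
  apply: eq_Rintegral => r; rewrite mem_setE in_itv/= => /andP[r0 _].
  by rewrite fint1 ?ltW// mulrCA; congr (_ * _); rewrite mulrC divfK ?gt0.
move=> E2; rewrite {1}/fint -E2 mulrBr [X in X - _]E BetaE//.
rewrite (addrAC a 1 b) (addrC b a).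
have := gt0 _ (addr_gt0 ab0 ltr01); have := gt0 _ b0; have := gt0 _ a10.
move: (Gamma (a + 1)) (Gamma b) (Gamma (a + b + 1)) (_ `^ _)
  (reg_inc_beta _ _ _) => x y z w i x0 y0 z0.
by field; rewrite x0 y0 z0.
Qed.

Lemma continuous_scale c g : continuous g -> continuous (fun x => c * g x).
Proof. by move=> cg x; apply: cvgM; [exact: cvg_cst | exact: cg]. Qed.

(** The semigroup law cancels the power at [t], and the power at [t + c] cancels against the 1 in
    [fint_shifted_power], so only the incomplete Beta term survives. *)
Lemma fint_forced_difference a b c y g t :
  0 < a -> 0 < b -> 0 < c -> 0 <= t -> continuous g ->
  y * (fint (a + b) (cst 1) (t + c) - fint (a + b) (cst 1) t) +
  fint b (fun x => g x +
    (y * fint a (cst 1) x - y * fint a (cst 1) (x + c))) t =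
  y * ((t + c) `^ (a + b) / Gamma (a + b + 1) *
       reg_inc_beta (c / (t + c)) (a + 1) b) + fint b g t.
Proof.
move=> a0 b0 c0 t0 cg.
have tc0 : 0 <= t + c by rewrite addr_ge0// ltW.
have cP : continuous (fint a (cst 1)) := continuous_fint1 a0.
have cPc := continuous_shift (c := c) cP.
have cyP := continuous_scale (c := y) cP; have cyPc := continuous_scale (c := y) cPc.
have cB : continuous (fun x => y * fint a (cst 1) x - y * fint a (cst 1) (x + c)).
  by move=> x; apply: cvgB; [exact: cyP | exact: cyPc].
have c1 : continuous (cst 1 : R -> R) by move=> x; exact: cvg_cst.
have -> := fintD t b0 cg cB.
have -> := fintB t b0 cyP cyPc.
have -> := fintZ y t b0 cP.
have -> := fintZ y t b0 cPc.
have -> := fint_shifted_power a0 b0 t0 c0.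
have -> := fint_fint t b0 a0 c1.
rewrite (addrC b a) (fint1 (addr_gt0 a0 b0) tc0).
move: (fint b g t) (fint _ (cst 1) t) (reg_inc_beta _ _ _) (_ / Gamma _).
by move=> p q r s; ring.
Qed.

(** Fractional integrals vanish left of 0, so the delays come out of [fint a]; the semigroup law
    then raises each order by [a]. *)
Lemma fint_shifted_difference a b b' c y g t :
  0 < a -> 0 < b -> 0 < b' -> 0 <= c -> continuous g ->
  fint a (fun x => y * (fint b (cst 1) x - fint b (cst 1) (x - c)) +
    fint b' g (x - c)) t =
  y * (fint (a + b) (cst 1) t - fint (a + b) (cst 1) (t - c)) +
    fint (a + b') g (t - c).
Proof.
move=> a0 b0 b'0 c0 cg.
have c1 : continuous (cst 1 : R -> R) by move=> x; exact: cvg_cst.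
have cP : continuous (fint b (cst 1)) := continuous_fint1 b0.
have cPc := continuous_shift (c := - c) cP.
have cG : continuous (fint b' g) := fint_continuous b'0 cg.
have cGc := continuous_shift (c := - c) cG.
have cD : continuous (fun x => fint b (cst 1) x - fint b (cst 1) (x - c)).
  by move=> x; apply: cvgB; [exact: cP | exact: cPc].
have -> := fintD t a0 (continuous_scale (c := y) cD) cGc.
have -> := fintZ y t a0 cD.
have -> := fintB t a0 cP cPc.
have -> := fint_shift a t cP c0 (fun x => @fint_le0 _ b (cst 1) x).
have -> := fint_shift a t cG c0 (fun x => @fint_le0 _ b' g x).
have E1 s : fint a (fint b (cst 1)) s = fint (a + b) (cst 1) s.
  exact: fint_fint.
have E2 s : fint a (fint b' g) s = fint (a + b') g s by exact: fint_fint.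
by rewrite (E1 t) (E1 (t - c)) E2.
Qed.

End ShiftedPower.

(** * The terms of the solution *)

Section DelayComponents.
Context {R : realType}.
Variables (alpha tau y0 : R) (f : R -> R).
Hypothesis alpha01 : 0 < alpha < 1.
Hypothesis tau_gt0 : 0 < tau.
Hypothesis cf : {within `[0, +oo[, continuous f}.
Implicit Types (t x : R) (k : nat).

Let alpha_gt0 : 0 < alpha. Proof. by case/andP: alpha01. Qed.

Let onem_alpha_gt0 : 0 < 1 - alpha.
Proof. by rewrite subr_gt0; case/andP: alpha01. Qed.

Local Notation P b := (fint b (cst 1) : R -> R).

Lemma continuous_extension : continuous (fun x => f (Num.max x 0)).
Proof.
have [cpos /= cf0] := (continuous_within_itvcyP 0 f).1 cf.
move=> t; rewrite /continuous_at; have [t0|t0|->] := ltgtP t 0.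
- apply: cvg_near_cst; apply: filterS (lt_nbhsl t0) => s s0.
  by rewrite max_r// ltW.
- have ct : f x @[x --> t] --> f t by apply: cpos; rewrite in_itv/= t0.
  apply: cvg_trans ct; apply: near_eq_cvg.
  by apply: filterS (lt_nbhsr t0) => s s0; rewrite max_l// ltW.
- rewrite -[X in _ --> f X](maxxx (0 : R)).
  apply/(left_right_continuousP (fun x => f (Num.max x 0))).
  rewrite maxxx; split.
    apply: cvg_near_cst; apply: filterS (nbhs_left_lt (0 : R)) => s s0.
    by rewrite max_r// ltW.
  apply: cvg_trans cf0; apply: near_eq_cvg.
  by apply: filterS (nbhs_right_gt (0 : R)) => s s0; rewrite max_l// ltW.
Qed.

Lemma derive1_affine_history x : derive1 (affine_history tau y0) x = y0 / tau.
Proof.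
have -> : affine_history tau y0 = (y0 / tau) \*: id + cst y0.
  by apply/funext => z; rewrite /affine_history fctE/= [_ *: _]mulrC; ring.
by rewrite derive1E derive_val addr0 [_ *: _]mulr1.
Qed.

Lemma caputo0_affine_history t :
  caputo alpha 0 (affine_history tau y0) t = fint (1 - alpha) (cst (y0 / tau)) t.
Proof.
have e : 1 - alpha - 1 = - alpha by ring.
rewrite /caputo /fint e; congr (_ * _); apply: eq_Rintegral => r _.
by rewrite derive1_affine_history.
Qed.

(** The derivative of the history is constant, so a translation by [tau] moves the base point from
    [- tau] to 0. *)
Lemma caputo_history_affine_history t :
  caputo alpha (- tau) (affine_history tau y0) t =
  fint (1 - alpha) (cst (y0 / tau)) (t + tau).
Proof.
have e : 1 - alpha - 1 = - alpha by ring.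
have /= := @Rintegral_fint_shift R (1 - alpha) tau (- tau) (cst (y0 / tau)) t
  (fun x => @cst_continuous _ _ _ x).
rewrite addNr e => E.
rewrite /caputo /fint e -E; congr (_ * _); apply: eq_Rintegral => r _.
by rewrite derive1_affine_history.
Qed.

(* f is prolonged by a constant, so that the forcing term is continuous on the
   whole line. *)
Definition forcing t : R :=
  f (Num.max t 0) + (y0 / tau * P (1 - alpha) t - y0 / tau * P (1 - alpha) (t + tau)).

Lemma forcing_continuous : continuous forcing.
Proof.
move=> x; apply: cvgD; first exact: continuous_extension.
apply: cvgB; (apply: cvgM; first exact: cvg_cst).
  exact: continuous_fint1.
exact: (continuous_shift (continuous_fint1 onem_alpha_gt0)).
Qed.

Lemma forcingE t : 0 <= t ->
  f t + history_forcing alpha tau (affine_history tau y0) t = forcing t.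
Proof.
move=> t0; rewrite /forcing max_l//; congr (_ + _).
have c0E s : y0 / tau * P (1 - alpha) s = fint (1 - alpha) (cst (y0 / tau)) s.
  rewrite -fintZ//; last by move=> r; exact: cvg_cst.
  by apply: eq_fint => r _; rewrite /= mulr1.
rewrite /history_forcing caputo0_affine_history caputo_history_affine_history.
by congr (_ - _); exact/esym/c0E.
Qed.

(* The solution is the sum over k of lambda^k * delay_term k (t + tau - k * tau);
   the argument is shifted by tau so that each term vanishes left of 0. *)
Definition delay_term k t : R :=
  y0 / tau * (P (alpha * k%:R + 1) t - P (alpha * k%:R + 1) (t - tau)) +
  fint (alpha * k%:R + alpha) forcing (t - tau).

Let exp1_gt0 k : 0 < alpha * k%:R + 1.
Proof. by rewrite ltr_wpDl// mulr_ge0// ltW. Qed.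

Let expa_gt0 k : 0 < alpha * k%:R + alpha.
Proof. by rewrite ltr_wpDl// mulr_ge0// ltW. Qed.

(** This makes the series over [k] a finite sum at each time. *)
Lemma delay_term_le0 k t : t <= 0 -> delay_term k t = 0.
Proof.
move=> t0; have tt : t - tau <= 0 by rewrite (le_trans _ t0)// gerBl ltW.
by rewrite /delay_term !fint_le0// subrr mulr0 addr0.
Qed.

Let Pshift_continuous k : continuous (fun t => P (alpha * k%:R + 1) (t - tau)).
Proof. exact: (continuous_shift (continuous_fint1 _)). Qed.

Let Pdiff_continuous k : continuous (fun t => y0 / tau *
  (P (alpha * k%:R + 1) t - P (alpha * k%:R + 1) (t - tau))).
Proof.
move=> x; apply: cvgM; first exact: cvg_cst.
by apply: cvgB; [exact: continuous_fint1 | exact: Pshift_continuous].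
Qed.

Let Fshift_continuous k :
  continuous (fun t => fint (alpha * k%:R + alpha) forcing (t - tau)).
Proof.
apply: (@continuous_shift _ (fint _ forcing)).
by apply: fint_continuous => //; exact: forcing_continuous.
Qed.

Lemma delay_term_continuous k : continuous (delay_term k).
Proof.
by move=> x; apply: cvgD; [exact: Pdiff_continuous | exact: Fshift_continuous].
Qed.

Lemma fint_delay_term k t : fint alpha (delay_term k) t = delay_term k.+1 t.
Proof.
have e1 : alpha + (alpha * k%:R + 1) = alpha * k.+1%:R + 1.
  by rewrite -natr1; ring.
have e2 : alpha + (alpha * k%:R + alpha) = alpha * k.+1%:R + alpha.
  by rewrite -natr1; ring.
rewrite /delay_term -e1 -e2; apply: fint_shifted_difference => //; first exact: ltW.
exact: forcing_continuous.
Qed.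

Lemma fint_delay_term_shift k c t : 0 <= c ->
  fint alpha (fun r => delay_term k (r - c)) t = delay_term k.+1 (t - c).
Proof.
move=> c0; rewrite fint_shift ?fint_delay_term//; first exact: delay_term_continuous.
by move=> x; exact: delay_term_le0.
Qed.

(** Since [J^1 1 (t) = t] for [t >= 0], the difference in [delay_term] equals [tau], and [y0 / tau]
    turns it into the initial value [y0]. *)
Lemma delay_term0E t : 0 <= t ->
  delay_term 0 (t + tau) = y0 + fint alpha forcing t.
Proof.
move=> t0; rewrite /delay_term mulr0 !add0r addrK; congr (_ + _).
have tt : 0 <= t + tau by rewrite addr_ge0// ltW.
rewrite (fint1 ltr01 t0) (fint1 ltr01 tt) (powRr1 t0) (powRr1 tt).
rewrite GammaS// Gamma1 mul1r !divr1 addrAC subrr add0r.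
by rewrite divfK// gt_eqF.
Qed.

Lemma delay_term0_history t : - tau <= t <= 0 -> delay_term 0 (t + tau) = affine_history tau y0 t.
Proof.
move=> /andP[tl t0]; rewrite /delay_term mulr0 !add0r addrK.
rewrite [fint alpha _ _]fint_le0// [X in _ - X]fint_le0// addr0 subr0.
have tt : 0 <= t + tau by rewrite -[X in X <= _](subrr tau) addrC lerD2r.
rewrite (fint1 ltr01 tt) (powRr1 tt) GammaS// Gamma1 mul1r divr1 /affine_history.
by field; rewrite gt_eqF.
Qed.

(** Before one delay has elapsed, both parts evaluated at [t - tau] are still 0. This handles the
    last term of the final sum. *)
Lemma delay_term_lt_delay k t : 0 <= t < tau ->
  delay_term k t = y0 / tau * (t `^ (alpha * k%:R + 1) / Gamma (alpha * k%:R + 2)).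
Proof.
move=> /andP[t0 tt]; have tt0 : t - tau <= 0 by rewrite subr_le0 ltW.
rewrite /delay_term (fint1 (exp1_gt0 k) t0) (fint_le0 _ _ tt0) (fint_le0 _ forcing tt0).
by rewrite subr0 addr0 -addrA.
Qed.

(** [fint_forced_difference] with [a = 1 - alpha], [b = alpha k + alpha], [c = tau] and
    [y = y0 / tau], so that [a + b = alpha k + 1] and [a + 1 = 2 - alpha]. *)
Lemma delay_term_closed_form k t : 0 <= t ->
  delay_term k (t + tau) = y0 / tau *
      ((t + tau) `^ (alpha * k%:R + 1) / Gamma (alpha * k%:R + 2) *
       reg_inc_beta (tau / (t + tau)) (2 - alpha) (k.+1%:R * alpha)) +
    fint (alpha * k%:R + alpha) f t.
Proof.
move=> t0; have b0 := expa_gt0 k; set b := alpha * k%:R + alpha in b0 *.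
have tt : 0 <= t + tau by rewrite addr_ge0// ltW.
have bE : k.+1%:R * alpha = b by rewrite /b -natr1; ring.
have eE : alpha * k%:R + 1 = 1 - alpha + b by rewrite /b; ring.
have eE2 : alpha * k%:R + 2 = 1 - alpha + b + 1 by rewrite /b; ring.
have aE : 2 - alpha = 1 - alpha + 1 by ring.
have fE : fint b f t = fint b (fun r => f (Num.max r 0)) t.
  by apply: eq_fint => r /andP[r0 _]; rewrite max_l// ltW.
rewrite /delay_term addrK -/b fE bE eE eE2 aE.
apply: fint_forced_difference => //; exact: continuous_extension.
Qed.

End DelayComponents.

(** * Solution and uniqueness *)

Section ComplexCombination.
Context {R : realType}.
Implicit Types (a t : R) (N : nat).

Lemma eq_Cintegral (D : set R) (g h : R -> R[i]) :
  {in D, g =1 h} -> Cintegral D g = Cintegral D h.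
Proof.
by move=> gh; congr (_ +i* _); apply: eq_Rintegral => r rD; rewrite gh.
Qed.

Lemma Re_realM (x : R) (z : R[i]) : complex.Re (x%:C * z) = x * complex.Re z.
Proof. by case: z => p q /=; rewrite mul0r subr0. Qed.

Lemma Im_realM (x : R) (z : R[i]) : complex.Im (x%:C * z) = x * complex.Im z.
Proof. by case: z => p q /=; rewrite mul0r addr0. Qed.

Lemma Re_combination N (c : nat -> R[i]) (x : nat -> R) :
  complex.Re (\sum_(k < N) c k * (x k)%:C) = \sum_(k < N) complex.Re (c k) * x k.
Proof.
rewrite raddf_sum; apply: eq_bigr => k _; case: (c k) => p q /=.
by rewrite mulr0 subr0.
Qed.

Lemma Im_combination N (c : nat -> R[i]) (x : nat -> R) :
  complex.Im (\sum_(k < N) c k * (x k)%:C) = \sum_(k < N) complex.Im (c k) * x k.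
Proof.
rewrite raddf_sum; apply: eq_bigr => k _; case: (c k) => p q /=.
by rewrite mulr0 add0r.
Qed.

Lemma continuous_combination N (x : nat -> R) (g : nat -> R -> R) :
  (forall k, continuous (g k)) -> continuous (fun r => \sum_(k < N) x k * g k r).
Proof.
move=> cg; elim: N => [|N IH] r.
  under eq_fun do rewrite big_ord0; exact: cvg_cst.
under eq_fun do rewrite big_ord_recr/=.
apply: cvgD; first exact: IH.
by apply: cvgM; [exact: cvg_cst | exact: cg].
Qed.

Lemma fint_combination a N (x : nat -> R) (g : nat -> R -> R) t :
  0 < a -> (forall k, continuous (g k)) ->
  fint a (fun r => \sum_(k < N) x k * g k r) t = \sum_(k < N) x k * fint a (g k) t.
Proof.
move=> a0 cg; elim: N => [|N IH].
  rewrite big_ord0 -[RHS](mul0r (fint a (cst 1) t)).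
  rewrite -fintZ//; last by move=> r; exact: cvg_cst.
  by apply: eq_fint => r _; rewrite big_ord0 mul0r.
rewrite big_ord_recr/= -IH -fintZ// -fintD//.
- by apply: eq_fint => r _; rewrite big_ord_recr.
- exact: continuous_combination.
- exact: continuous_scale.
Qed.

(** Kernel and functions are real and only the coefficients are complex, so real linearity applies
    to real and imaginary parts separately. *)
Lemma Cintegral_combination a N (c : nat -> R[i]) (g : nat -> R -> R) t :
  0 < a -> (forall k, continuous (g k)) ->
  ((Gamma a)^-1)%:C * Cintegral `]0, t[ (fun r =>
    ((t - r) `^ (a - 1))%:C * \sum_(k < N) c k * (g k r)%:C) =
  \sum_(k < N) c k * (fint a (g k) t)%:C.
Proof.
move=> a0 cg; apply/eqP; rewrite eq_complex; apply/andP; split; apply/eqP.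
  rewrite Re_realM (Re_combination N c (fun k => fint a (g k) t)).
  rewrite -(fint_combination N (fun k => complex.Re (c k)) t a0 cg).
  congr (_ * _); apply: eq_Rintegral => r _.
  by rewrite Re_realM (Re_combination N c (fun k => g k r)).
rewrite Im_realM (Im_combination N c (fun k => fint a (g k) t)).
rewrite -(fint_combination N (fun k => complex.Im (c k)) t a0 cg).
congr (_ * _); apply: eq_Rintegral => r _.
by rewrite Im_realM (Im_combination N c (fun k => g k r)).
Qed.

Lemma continuous_real_complex (g : R -> R) : continuous g ->
  continuous (fun x => (g x)%:C : (R[i] : numFieldType)).
Proof.
move=> cg x; apply/cvgrPdist_lt => e e0.
(* A positive element of [R[i]] has zero imaginary part, so the tolerance is a positive real. *)
have /andP[/eqP ime Re0] : (complex.Im e == 0) && (0 < complex.Re e).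
  by move: e0; rewrite ltcE/= eq_sym.
have /cvgrPdist_lt/(_ _ Re0) := cg x.
apply: filterS => y.
rewrite -rmorphB normc_def/= expr0n addr0 sqrtr_sqr => gy.
by rewrite ltcE/= ime eqxx gy.
Qed.

Lemma continuous_complex_combination N (c : nat -> R[i]) (g : nat -> R -> R) :
  (forall k, continuous (g k)) ->
  continuous (fun r => \sum_(k < N) c k * (g k r)%:C : (R[i] : numFieldType)).
Proof.
move=> cg; elim: N => [|N IH] r.
  under eq_fun do rewrite big_ord0; exact: cvg_cst.
under eq_fun do rewrite big_ord_recr/=.
apply: cvgD; first exact: IH.
by apply: cvgM; [exact: cvg_cst | exact: continuous_real_complex].
Qed.

End ComplexCombination.

(** * Superposition of delayed terms and the method of steps *)

Section DelaySolution.
Context {R : realType}.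
Variables (alpha tau y0 : R) (lambda : R[i]) (f : R -> R).
Hypothesis alpha01 : 0 < alpha < 1.
Hypothesis tau_gt0 : 0 < tau.
Hypothesis cf : {within `[0, +oo[, continuous f}.
Implicit Types (t : R) (k n N : nat) (u v : R -> R[i]).

Local Notation W := (delay_term alpha tau y0 f).

Definition steps N t : R[i] :=
  \sum_(k < N) lambda ^+ k * (W k (t + tau - k%:R * tau))%:C.

(** The number of terms [N] satisfies [t + tau <= N tau], so all omitted terms vanish at [t]; [|t|]
    treats both signs alike. *)
Definition delay_sum t : R[i] := steps (Num.truncn (`|t| / tau)).+2 t.

Lemma steps_stable N n t : t + tau <= N%:R * tau -> steps (N + n) t = steps N t.
Proof.
move=> tN; elim: n => [|n IH]; first by rewrite addn0.
rewrite addnS /steps big_ord_recr/= -/(steps _ _) IH delay_term_le0// ?mulr0 ?addr0//.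
by rewrite subr_le0 (le_trans tN)// ler_wpM2r ?(ltW tau_gt0)// ler_nat leq_addr.
Qed.

Lemma delay_sumE N t : t + tau <= N%:R * tau -> delay_sum t = steps N t.
Proof.
move=> tN; rewrite /delay_sum; set M := (X in steps X t).
have tM : t + tau <= M%:R * tau.
  rewrite /M -[_.+2]addn1 natrD mulrDl mul1r lerD2r (le_trans (ler_norm t))//.
  by rewrite -ler_pdivrMr// ltW// truncnS_gt.
by rewrite -(steps_stable N tM) addnC steps_stable.
Qed.

Lemma delay_sum_continuous : continuous (delay_sum : R -> (R[i] : numFieldType)).
Proof.
(* Chosen for [t + 1], so that one partial sum represents [delay_sum] on a neighbourhood of [t]. *)
move=> t; pose N := (Num.truncn ((t + 1) / tau)).+2.
have tN : t + 1 + tau <= N%:R * tau.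
  rewrite /N -[_.+2]addn1 natrD mulrDl mul1r lerD2r.
  by rewrite -ler_pdivrMr// ltW// truncnS_gt.
have cs : continuous (steps N : R -> (R[i] : numFieldType)).
  have := @continuous_complex_combination R N (fun k => lambda ^+ k)
    (fun k r => W k (r + tau - k%:R * tau)).
  apply => k.
  have -> : (fun r => W k (r + tau - k%:R * tau)) =
    (fun r => W k (r + (tau - k%:R * tau))).
    by apply/funext => r; rewrite addrA.
  by apply: continuous_shift; exact: delay_term_continuous.
have tt : t < t + 1 by rewrite ltrDl.
rewrite /continuous_at (@delay_sumE N); last first.
  by rewrite (le_trans _ tN)// lerD2r ltW.
apply: cvg_trans (cs t); apply: near_eq_cvg.
apply: filterS (lt_nbhsl tt) => s st; rewrite (@delay_sumE N)//.
by rewrite (le_trans _ tN)// lerD2r ltW.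
Qed.

Lemma delay_sum_solution :
  modified_GL_solution alpha tau lambda (affine_history tau y0) f delay_sum.
Proof.
have /andP[alpha_gt0 _] := alpha01.
split.
- by apply: continuous_subspaceT; exact: delay_sum_continuous.
- move=> t /andP[tl t0].
  (* On the history interval only the term [k = 0] can be nonzero. *)
  rewrite (@delay_sumE 1); last by rewrite mul1r gerDr.
  rewrite /steps big_ord1 expr0 mul1r mul0r subr0 delay_term0_history ?tl//.
move=> t t0; set N := (Num.truncn (t / tau)).+1.
have tN : t <= N%:R * tau by rewrite -ler_pdivrMr// ltW// truncnS_gt.
rewrite (@delay_sumE N.+1); last by rewrite -natr1 mulrDl mul1r lerD2r.
(* The right-hand side as one combination: index 0 is the forcing, and index [j + 1] is the [j]-th
   term at time [r - tau], whose coefficient gains a factor [lambda]. *)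
pose g k := if k is j.+1 then fun r => W j (r - j%:R * tau)
  else forcing alpha tau y0 f.
have cg k : continuous (g k).
  case: k => [|k]; first exact: forcing_continuous.
  by apply: continuous_shift; exact: delay_term_continuous.
have -> : Cintegral `]0, t[ (fun r => ((t - r) `^ (alpha - 1))%:C *
      (lambda * delay_sum (r - tau) +
       (f r + history_forcing alpha tau (affine_history tau y0) r)%:C)) =
    Cintegral `]0, t[ (fun r => ((t - r) `^ (alpha - 1))%:C *
      \sum_(k < N.+1) lambda ^+ k * (g k r)%:C).
  apply: eq_Cintegral => r; rewrite mem_setE in_itv/= => /andP[r0 rt].
  congr (_ * _); rewrite (@delay_sumE N); last first.
    by rewrite subrK (le_trans (ltW rt)).
  rewrite big_ord_recl expr0 mul1r addrC forcingE// ?ltW//; congr (_ + _).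
  rewrite /steps mulr_sumr; apply: eq_bigr => k _ /=.
  by rewrite subrK exprS mulrA.
rewrite Cintegral_combination// big_ord_recl/= expr0 mul1r.
rewrite /steps big_ord_recl/= expr0 mul1r mul0r subr0 delay_term0E//.
have -> : affine_history tau y0 0 = y0.
  by rewrite /affine_history mul0r add0r mul1r.
rewrite rmorphD -[LHS]addrA; congr (_ + (_ + _)).
(* Fractional integration raises the index by one, and [t + tau - (k+1) tau = t - k tau]. *)
apply: eq_bigr => k _; congr (_ * _%:C).
have kt : 0 <= k%:R * tau by rewrite mulr_ge0// ltW.
apply: etrans (esym (fint_delay_term_shift y0 alpha01 tau_gt0 cf k t kt)).
by congr (W _ _); rewrite /bump/= add1n -natr1; ring.
Qed.

(** For [t <= (n+1) tau] the integral equation uses the solution only at times [r - tau <= n tau],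
    where the induction hypothesis applies. *)
Lemma delay_solution_unique phi F u v n t :
  delay_solution alpha tau lambda phi F u ->
  delay_solution alpha tau lambda phi F v ->
  - tau <= t <= n%:R * tau -> u t = v t.
Proof.
move=> [_ uh ui] [_ vh vi].
elim: n t => [|n IH] t /andP[tl tn]; have [t0|t0] := leP t 0.
- by rewrite uh ?vh// tl t0.
- by move: tn; rewrite mul0r leNgt t0.
- by rewrite uh ?vh// tl t0.
rewrite ui ?vi ?ltW//; congr (_ + _ * _).
apply: eq_Cintegral => r; rewrite mem_setE in_itv/= => /andP[r0 rt].
rewrite IH// -[X in X <= _]add0r lerD2r (ltW r0)/=.
rewrite lerBlDr (le_trans (ltW rt))// (le_trans tn)//.
by rewrite -natr1 mulrDl mul1r.
Qed.

End DelaySolution.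

(** * Closed form on each delay interval *)

Theorem proposition12 (R : realType) (alpha tau : R) (lambda : R[i])
    (f : R -> R) (y0 : R)
    (alpha01 : 0 < alpha < 1) (tau_gt0 : 0 < tau)
    (cf : {within `[0, +oo[, continuous f}) :
  (exists u : R -> R[i],
     modified_GL_solution alpha tau lambda (affine_history tau y0) f u) /\
  forall u : R -> R[i],
    modified_GL_solution alpha tau lambda (affine_history tau y0) f u ->
    forall (t : R) (p : nat), 0 < t ->
      p%:R * tau <= t < p.+1%:R * tau ->
      u t = (y0 / tau)%:C *
        (lambda ^+ p.+1 *
           ((t - p%:R * tau) `^ (alpha * p.+1%:R + 1)
              / Gamma (alpha * p.+1%:R + 2))%:C
         + \sum_(k < p.+1)
             (lambda ^+ k *
               ((t + tau - k%:R * tau) `^ (alpha * k%:R + 1)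
                  / Gamma (alpha * k%:R + 2)
                * reg_inc_beta (tau / (t + tau - k%:R * tau))
                    (2 - alpha) (k.+1%:R * alpha))%:C))
        + Jint alpha tau lambda f t.
Proof.
have sol := delay_sum_solution y0 lambda alpha01 tau_gt0 cf.
split; first by exists (delay_sum alpha tau y0 lambda f).
move=> u usol t p t0 /andP[pt tp].
have -> : u t = delay_sum alpha tau y0 lambda f t.
  apply: (delay_solution_unique usol sol (n := p.+1)).
  by rewrite (ltW tp) andbT (le_trans _ (ltW t0))// oppr_le0 ltW.
(* From [t < (p+1) tau] it follows that the [p + 2] terms [k = 0, ..., p + 1] suffice. *)
rewrite (delay_sumE _ _ _ _ tau_gt0 (N := p.+2)); last first.
  by rewrite -[p.+2%:R]natr1 mulrDl mul1r lerD2r ltW.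
have pE : Num.truncn (t / tau) = p.
  by apply: truncn_def; rewrite ler_pdivlMr// ltr_pdivrMr// pt tp.
rewrite /Jint pE /steps big_ord_recr/= mulrDr -[RHS]addrA [LHS]addrC; congr (_ + _).
  (* The last term is evaluated at [t - p tau], which lies in [[0, tau[]; this gives the isolated
     power. *)
  have -> : t + tau - p.+1%:R * tau = t - p%:R * tau by rewrite -natr1; ring.
  rewrite delay_term_lt_delay//; last first.
    rewrite subr_ge0 pt/= ltrBlDr (lt_le_trans tp)//.
    by rewrite -natr1 mulrDl mul1r addrC.
  by rewrite rmorphM mulrCA.
rewrite mulr_sumr -big_split/=; apply: eq_bigr => k _.
(* For [k <= p] the closed form applies at [t - k tau]; its integral of [f] is the [k]-th term of
   [Jint]. *)
have kt : 0 <= t - k%:R * tau.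
  rewrite subr_ge0 (le_trans _ pt)// ler_wpM2r ?(ltW tau_gt0)// ler_nat.
  by rewrite -ltnS ltn_ord.
have := delay_term_closed_form y0 alpha01 tau_gt0 cf k kt.
rewrite [t - _ + tau]addrAC => ->.
by rewrite rmorphD rmorphM mulrDr mulrCA.
Qed.
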